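(* Let $G$ be a finite simple graph on $n$ vertices without isolated vertices, and let $k$ be an integer with $2\le k\le n$. Let $\lambda_0\le\lambda_1\le\dots\le\lambda_{n-1}$ be the eigenvalues (with multiplicity) of the normalized Laplacian matrix $\mathbf L(G)=\mathbf I-\mathbf D^{-1/2}\mathbf A\mathbf D^{-1/2}$. Then (i) $\psi_k(G)\,k\le\lambda_{n-(k-1)}$, and (ii) $\phi_k(G)\,k\ge\lambda_{k-1}$.
   Context: $\mathbf A$ is the adjacency matrix of $G$ and $\mathbf D$ is the diagonal matrix of vertex degrees. A $k$-partition of $V(G)$ is a partition $\pi=\{S_1,\dots,S_k\}$ of $V(G)$ into $k$ nonempty classes. For $i\ne j$, $e(S_i,S_j)$ is the number of edges of $G$ between $S_i$ and $S_j$; $\mathrm{Vol}(S)$ is the sum of the degrees of the vertices in $S$. For a $k$-partition $\pi$ define \[\gamma(\pi)=\frac{\min_{i\ne j}e(S_i,S_j)}{\max_i\mathrm{Vol}(S_i)},\qquad \gamma^*(\pi)=\frac{\max_{i\ne j}e(S_i,S_j)}{\min_i\mathrm{Vol}(S_i)},\] and set $\psi_k(G)=\max_\pi\gamma(\pi)$ and $\phi_k(G)=\min_\pi\gamma^*(\pi)$, where both range over all $k$-partitions $\pi$ of $V(G)$. *)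

(* Defs.v *)
From HB Require Import structures.
From mathcomp Require Import all_boot all_order all_algebra.
Set Implicit Arguments.
Unset Strict Implicit.
Unset Printing Implicit Defensive.
Import Order.TTheory GRing.Theory Num.Theory.
Local Open Scope ring_scope.

(* The default [head 0 s] is itself an element of [s] when [s] is nonempty, so
   these are the true minimum and maximum of a nonempty sequence; both are 0 on
   the empty sequence. *)
Definition minseq (R : realDomainType) (s : seq R) : R :=
  \big[Num.min/head 0 s]_(x <- s) x.

Definition maxseq (R : realDomainType) (s : seq R) : R :=
  \big[Num.max/head 0 s]_(x <- s) x.

(* [lam] lists the eigenvalues of [M] in nondecreasing order, repeated
   according to their multiplicity as roots of the characteristic polynomial;
   the equation forces [size lam = n]. *)
Definition ordered_spectrum (R : realDomainType) (n : nat) (M : 'M[R]_n)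
    (lam : seq R) : Prop :=
  sorted <=%R lam /\ char_poly M = \prod_(a <- lam) ('X - a%:P).

Section Graph.
Variables (T : finType) (e : rel T).

Definition simple_graph : Prop := symmetric e /\ irreflexive e.

Definition no_isolated : Prop := forall x : T, exists y : T, e x y.

Definition degree (x : T) : nat := #|[set y | e x y]|.

Definition vol (A : {set T}) : nat := (\sum_(x in A) degree x)%N.

(* For disjoint [A] and [B], every edge between them corresponds to exactly one
   such ordered pair. *)
Definition edges_between (A B : {set T}) : nat :=
  #|[set p : T * T | [&& p.1 \in A, p.2 \in B & e p.1 p.2]]|.

(* [partition] already requires the classes to be nonempty. *)
Definition kpartitions (k : nat) : {set {set {set T}}} :=
  [set P : {set {set T}} | partition P [set: T] & #|P| == k].

Section Field.
Variable R : rcfType.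

Definition cross_counts (P : {set {set T}}) : seq R :=
  [seq (edges_between c.1 c.2)%:R
     | c : {set T} * {set T} in
         [set c : {set T} * {set T} | [&& c.1 \in P, c.2 \in P & c.1 != c.2]]].

Definition volumes (P : {set {set T}}) : seq R :=
  [seq (vol A)%:R | A : {set T} in P].

Definition gamma (P : {set {set T}}) : R :=
  minseq (cross_counts P) / maxseq (volumes P).

Definition gamma_star (P : {set {set T}}) : R :=
  maxseq (cross_counts P) / minseq (volumes P).

Definition psi (k : nat) : R :=
  maxseq [seq gamma P | P : {set {set T}} in kpartitions k].

Definition phi (k : nat) : R :=
  minseq [seq gamma_star P | P : {set {set T}} in kpartitions k].

(* Rows and columns are indexed by the vertices through [enum_val]. *)
Definition adjacency : 'M[R]_#|T| :=
  \matrix_(i, j) (e (enum_val i) (enum_val j))%:R.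

(* The matrix D^{-1/2}, where D is the diagonal matrix of vertex degrees. *)
Definition inv_sqrt_degree : 'M[R]_#|T| :=
  diag_mx (\row_i (Num.sqrt (degree (enum_val i))%:R)^-1).

Definition normalized_laplacian : 'M[R]_#|T| :=
  1%:M - inv_sqrt_degree *m adjacency *m inv_sqrt_degree.

End Field.
End Graph.

(* Main.v *)
Require Import Defs.
From HB Require Import structures.
From mathcomp Require Import all_boot all_order all_algebra.
From mathcomp Require Import perm complex ring.
Set Implicit Arguments.
Unset Strict Implicit.
Unset Printing Implicit Defensive.
Import Order.TTheory GRing.Theory Num.Theory.
Local Open Scope ring_scope.
Local Open Scope sesquilinear_scope.

(** Both bounds come from testing the Rayleigh quotient of the normalized
    Laplacian L on the vectors D^{1/2} f, where f is constant on each class of a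
    k-partition. If f takes the value g_A on the class A, then
    - the quadratic form of L is the Dirichlet energy
      sum_{A, B} e(A, B) (g_A - g_B)^2 / 2  ([form_laplacian_stepfun]);
    - the squared norm is sum_A Vol(A) g_A^2  ([form1_stepfun]).
    With all the e(A, B) replaced by one constant, the energy becomes that of the
    complete graph on the classes, k sum_A g_A^2 - (sum_A g_A)^2
    ([sum_sqr_diff]). Hence, for an arbitrary g, the Rayleigh quotient is at most
    k max e(A, B) / min Vol(A); and when sum_A g_A = 0 it is at least
    k min e(A, B) / max Vol(A). The vectors of the first kind form a space of
    dimension k, and those of the second kind a space of dimension k - 1.

    The rest is the Courant-Fischer principle: a Rayleigh quotient bounded above
    by a on a space of dimension r forces the r-th smallest eigenvalue to be at
    most a, and one bounded below by a forces the r-th largest to be at least a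
    ([eigenvalue_le], [eigenvalue_ge]). Here r = k gives lambda_{k-1}, and
    r = k - 1 gives lambda_{n-(k-1)}. The principle rests on the unitary
    diagonalization of hermitian matrices, carried out over R[i]; the vectors it
    produces are complex, but the form of a real symmetric matrix at x + i z is
    the sum of its values at x and z, so only real test vectors matter. *)

(** * Courant-Fischer bounds for real symmetric matrices *)

Lemma char_poly_conj (F : comUnitRingType) n (P A : 'M[F]_n) :
  P \in unitmx -> char_poly (invmx P *m A *m P) = char_poly A.
Proof.
move=> unitP; set p := map_mx polyC P.
have Pp : map_mx polyC (invmx P) *m p = 1%:M.
  by rewrite -map_mxM mulVmx // map_mx1.
rewrite /char_poly.
have -> : char_poly_mx (invmx P *m A *m P)
          = map_mx polyC (invmx P) *m char_poly_mx A *m p.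
  rewrite /char_poly_mx mulmxBr mulmxBl !map_mxM -/p; congr (_ - _).
  by rewrite scalar_mxC -mulmxA Pp mulmx1.
by rewrite !det_mulmx mulrAC -det_mulmx Pp det1 mul1r.
Qed.

Section Spectral.
Variables (R : rcfType) (n : nat) (M : 'M[R]_n) (lam : seq R).
Hypotheses (symM : M^T = M) (specM : ordered_spectrum M lam).
Local Notation toC := (real_complex R).

Lemma size_spectrum : size lam = n.
Proof.
have [_ /(congr1 (fun p : {poly R} => size p))] := specM.
by rewrite size_char_poly size_prod_XsubC => -[].
Qed.

Lemma toC_conj (x : R) : (x%:C)%C^* = (x%:C)%C :> R[i].
Proof. by apply/CrealP/complex_realP; exists x. Qed.

(** The columns of [Q] are an orthonormal basis of eigenvectors, permuted so that
    the i-th one belongs to the i-th entry of the given list [lam]; the list of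
    diagonal entries of any diagonalization agrees with [lam] up to order since
    both factor the same characteristic polynomial. *)
Lemma spectral_coordinates : exists Q : 'M[R[i]]_n, forall w : 'rV[R[i]]_n,
  (w *m map_mx toC M *m w ^t*) 0 0 = \sum_(i < n) toC lam`_i * `|(w *m Q) 0 i| ^+ 2
  /\ (w *m w ^t*) 0 0 = \sum_(i < n) `|(w *m Q) 0 i| ^+ 2.
Proof.
have normalM : map_mx toC M \is normalmx.
  apply: symmetric_normalmx.
    by apply/is_hermitianmxP; rewrite expr0 scale1r map_mx_id // map_trmx symM.
  by apply/mxOverP=> i j; rewrite mxE; apply/complex_realP; exists (M i j).
have /orthomx_spectralP := normalM.
set P := spectralmx _; set sp := spectral_diag _ => defM.
have unitP : P \is unitarymx by apply: spectral_unitarymx.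
have invP := invmx_unitary unitP; have unitmxP := unitarymx_unit unitP.
have charM : char_poly (map_mx toC M) = \prod_(i < n) ('X - (sp 0 i)%:P).
  rewrite defM char_poly_conj // char_poly_trig ?diag_mx_is_trig //.
  by apply: eq_bigr => i _; rewrite mxE eqxx mulr1n.
have permsp : perm_eq (map toC lam) [tuple sp 0 i | i < n].
  apply: prod_XsubC_eq; rewrite [RHS]big_map big_enum /= -charM -map_char_poly.
  by rewrite specM.2 rmorph_prod big_map; apply: eq_bigr => a _;
     rewrite /= rmorphB /= map_polyX map_polyC.
have [s defs] := tuple_permP permsp.
have lamE (i : 'I_n) : toC lam`_i = sp 0 (s i).
  rewrite -(@nth_map _ _ _ 0) ?size_spectrum // defs.
  rewrite (nth_map i) ?size_enum_ord // nth_ord_enum tnth_mktuple //.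
exists (col_perm s (P ^t*)) => w.
have wQ i : (w *m col_perm s (P ^t*)) 0 i = (w *m P ^t*) 0 (s i).
  by rewrite !mxE; apply: eq_bigr => j _; rewrite !mxE.
have dualw : P *m w ^t* = (w *m P ^t*) ^t*.
  by rewrite trmx_mul map_mxM trmxCK.
split.
  rewrite {1}defM invP !mulmxA -[w *m _ *m _ *m P *m _]mulmxA dualw.
  rewrite mxE (reindex_perm s); apply: eq_bigr => i _.
  by rewrite wQ lamE normCK mul_mx_diag !mxE [_ * sp _ _]mulrC mulrA.
have -> : w *m w ^t* = (w *m P ^t*) *m (P *m w ^t*).
  by rewrite mulmxA -[w *m _ *m P]mulmxA -invP mulVmx // mulmx1.
rewrite dualw mxE (reindex_perm s); apply: eq_bigr => i _.
by rewrite wQ normCK !mxE.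
Qed.

Definition form (X : 'M[R]_n) (u : 'rV[R]_n) : R := (u *m X *m u^T) 0 0.

(** The cross terms i z X x^T and - i x X z^T cancel because [X] is symmetric. *)
Lemma hermitian_form_split (X : 'M[R]_n) (x z : 'rV[R]_n) : X^T = X ->
  let w := map_mx toC x + 'i%C *: map_mx toC z in
  (w *m map_mx toC X *m w ^t*) 0 0 = toC (form X x + form X z).
Proof.
move=> symX w.
have sq_i : 'i%C * 'i%C = -1 :> R[i] by rewrite -expr2 sqr_i.
have conjw : w ^t* = map_mx toC x^T - 'i%C *: map_mx toC z^T.
  apply/matrixP=> i j; rewrite !mxE rmorphD rmorphM /= !toC_conj.
  congr (_ + _); rewrite -mulNr; congr (_ * _).
  by apply/eqP; rewrite eq_complex /= oppr0 !eqxx.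
have cross : (x *m X *m z^T) 0 0 = (z *m X *m x^T) 0 0.
  have -> : z *m X *m x^T = (x *m X *m z^T)^T.
    by rewrite !trmx_mul trmxK symX mulmxA.
  by rewrite [RHS]mxE.
rewrite conjw mulmxDl !(mulmxBr, mulmxDl) -?scalemxAr -?scalemxAl -?scalemxAr.
rewrite -!map_mxM scalerA sq_i scaleN1r /form.
move: (x *m X *m x^T) (x *m X *m z^T) (z *m X *m x^T) (z *m X *m z^T) cross.
move=> xx xz zx zz cross; rewrite ![in LHS]mxE cross rmorphD /=; ring.
Qed.

(** The dimension count behind both halves of Courant-Fischer: fewer than
    [\rank U] linear conditions leave a nonzero complex vector x + i z in the
    span of [U] that has no component along the eigenvectors of index in [J].
    The weights [t i] are the squared moduli of its eigencoordinates. *)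
Lemma rayleigh_mean m (U : 'M[R]_(m, n)) (J : {set 'I_n}) : (#|J| < \rank U)%N ->
  exists x z : 'rV[R]_n, exists t : 'I_n -> R,
  [/\ (x <= U)%MS /\ (z <= U)%MS,
      forall i, 0 <= t i /\ (i \in J -> t i = 0),
      0 < \sum_i t i,
      form 1%:M x + form 1%:M z = \sum_i t i
    & form M x + form M z = \sum_(i < n) lam`_i * t i].
Proof.
move=> ltJU; have [Q spectralQ] := spectral_coordinates.
pose B := map_mx toC (row_base U).
pose S := colsub (fun i : 'I_#|J| => enum_val i) (B *m Q).
(* The columns of [S] list the coordinates of index in [J] of the basis of [U]. *)
have /rowV0Pn[v /sub_kermxP vS0 v_neq0] : kermx S != 0.
  by rewrite -mxrank_eq0 mxrank_ker -lt0n subn_gt0 (leq_ltn_trans (rank_leq_col _)).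
pose x := map_mx (@complex.Re R) v *m row_base U.
pose z := map_mx (@complex.Im R) v *m row_base U.
pose w := map_mx toC x + 'i%C *: map_mx toC z.
have wE : w = v *m B.
  rewrite /w !(map_mxM _ _ (row_base U)) scalemxAl -mulmxDl -/B; congr (_ *m _).
  by apply/matrixP=> i j; rewrite !mxE -complexE.
have w_neq0 : w != 0.
  by rewrite wE mulmx_free_eq0 // /row_free mxrank_map; apply: row_base_free.
pose t i := complex.Re (`|(w *m Q) 0 i| ^+ 2).
have tE i : toC (t i) = `|(w *m Q) 0 i| ^+ 2.
  by apply: RRe_real; rewrite rpredX // normr_real.
have [formw normw] := spectralQ w.
have norm1 : form 1%:M x + form 1%:M z = \sum_i t i.
  apply: (@complexI R); rewrite -hermitian_form_split ?trmx1 // map_mx1 mulmx1.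
  by rewrite -/w normw rmorph_sum; apply: eq_bigr => i _; rewrite /= tE.
exists x, z, t; split => //.
- by split; rewrite (submx_trans (submxMl _ _)) // eq_row_base.
- move=> i; split=> [|Ji]; first by rewrite -ler0c tE exprn_ge0.
  suff wQ0 : (w *m Q) 0 i = 0 by rewrite /t wQ0 normr0 expr0n.
  have : (v *m S) 0 (enum_rank_in Ji i) = 0 by rewrite vS0 mxE.
  by rewrite mulmx_colsub mulmxA -wE mxE enum_rankK_in.
- rewrite -norm1 -ltcR -hermitian_form_split ?trmx1 // map_mx1 mulmx1 -/w.
  rewrite mxE; have /rV0Pn[j wj_neq0] := w_neq0.
  rewrite (bigD1 j) //= ltr_pwDl ?sumr_ge0 // => [|i _];
    rewrite !mxE -normCK ?exprn_gt0 ?exprn_ge0 //.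
  by rewrite normr_gt0; move: wj_neq0; rewrite !mxE.
apply: (@complexI R); rewrite -hermitian_form_split // -/w formw rmorph_sum.
by apply: eq_bigr => i _; rewrite rmorphM /= tE.
Qed.

Lemma card_ord_interval p q (J : {set 'I_n}) :
  {in J, forall i : 'I_n, p <= i < q}%N -> (#|J| <= q - p)%N.
Proof.
move=> Jpq; rewrite cardE -(size_map val) -(size_iota p (q - p)).
apply: uniq_leq_size; first by rewrite (map_inj_uniq val_inj) enum_uniq.
move=> _ /mapP[i + ->]; rewrite mem_enum mem_iota => /Jpq /andP[lepi ltiq].
by rewrite lepi subnKC // ltnW // (leq_ltn_trans lepi).
Qed.

Lemma le_spectrum (i j : nat) : (i <= j)%N -> (j < n)%N -> lam`_i <= lam`_j.
Proof.
move=> leij ltjn; apply: (sorted_leq_nth le_trans lexx 0 specM.1) => //;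
  by rewrite inE size_spectrum // (leq_ltn_trans leij).
Qed.

(** A complex vector in the span of [U] orthogonal to the first [\rank U - 1]
    eigenvectors has a Rayleigh quotient of at least [lam`_(\rank U - 1)]. *)
Lemma eigenvalue_le m (U : 'M[R]_(m, n)) (a : R) : (0 < \rank U)%N ->
  (forall u, (u <= U)%MS -> form M u <= a * form 1%:M u) ->
  lam`_(\rank U - 1) <= a.
Proof.
move=> rU formU; pose J := [set i : 'I_n | i < \rank U - 1]%N.
have ltJ : (#|J| < \rank U)%N.
  have := @card_ord_interval 0 (\rank U - 1) J.
  rewrite subn0 => /(_ _)/leq_ltn_trans -> // => [i|]; rewrite ?inE //.
  by rewrite subn1 prednK.
have [x [z [t [[xU zU] t_ge0 t_gt0 norm1 formM]]]] := rayleigh_mean ltJ.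
rewrite -(ler_pM2r t_gt0) -{2}norm1 mulrDr.
apply: le_trans (lerD (formU x xU) (formU z zU)); rewrite formM mulr_sumr.
apply: ler_sum => i _; have [ti_ge0 ti0] := t_ge0 i.
have [Ji|] := boolP (i \in J); first by rewrite ti0 // !mulr0.
by rewrite inE -leqNgt => lei; rewrite ler_wpM2r // le_spectrum.
Qed.

(** A complex vector in the span of [U] orthogonal to the last [\rank U - 1]
    eigenvectors has a Rayleigh quotient of at most [lam`_(n - \rank U)]. *)
Lemma eigenvalue_ge m (U : 'M[R]_(m, n)) (a : R) : (0 < \rank U)%N ->
  (forall u, (u <= U)%MS -> a * form 1%:M u <= form M u) ->
  a <= lam`_(n - \rank U).
Proof.
move=> rU formU; pose J := [set i : 'I_n | n - \rank U < i]%N.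
have lern := rank_leq_col U.
have ltJ : (#|J| < \rank U)%N.
  have := @card_ord_interval (n - \rank U).+1 n J.
  move=> /(_ _)/leq_ltn_trans -> // => [i|]; rewrite ?inE ?ltn_ord ?andbT //.
  by rewrite subnS subKn // prednK.
have [x [z [t [[xU zU] t_ge0 t_gt0 norm1 formM]]]] := rayleigh_mean ltJ.
rewrite -(ler_pM2r t_gt0) -{1}norm1 mulrDr.
apply: le_trans (lerD (formU x xU) (formU z zU)) _; rewrite formM mulr_sumr.
apply: ler_sum => i _; have [ti_ge0 ti0] := t_ge0 i.
have [Ji|] := boolP (i \in J); first by rewrite ti0 // !mulr0.
rewrite inE -leqNgt => lei; rewrite ler_wpM2r // le_spectrum //.
by rewrite ltn_subrL rU (leq_trans rU lern).
Qed.

End Spectral.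

(** * Extrema of finite sequences and existence of partitions *)

Section Extrema.
Variables (R : realDomainType) (s : seq R).

Lemma minseq_le x : x \in s -> minseq s <= x.
Proof. by move=> sx; apply: (@bigmin_inf_seq _ _ _ s _ x xpredT x id). Qed.

Lemma maxseq_ge x : x \in s -> x <= maxseq s.
Proof. by move=> sx; apply: (@bigmax_sup_seq _ _ _ s _ x xpredT x id). Qed.

Lemma mem_head_nonnil : s != [::] -> head 0 s \in s.
Proof. by case: s => //= x s' _; rewrite mem_head. Qed.

Lemma minseq_mem : s != [::] -> minseq s \in s.
Proof.
move=> /mem_head_nonnil s_head; rewrite /minseq big_seq.
by elim/big_ind: _ => // x y sx sy; case: ltP.
Qed.

Lemma maxseq_mem : s != [::] -> maxseq s \in s.
Proof.
move=> /mem_head_nonnil s_head; rewrite /maxseq big_seq.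
by elim/big_ind: _ => // x y sx sy; case: ltP.
Qed.

End Extrema.

(** For lack of any k-partition, psi and phi would both be 0 and the bound from
    above on an eigenvalue would fail. The witness cuts an enumeration of the
    vertices into k - 1 singletons and one class with all that remains. *)
Lemma kpartitions_nonempty (T : finType) (k : nat) :
  (0 < k)%N -> (k <= #|T|)%N -> exists P, P \in kpartitions T k.
Proof.
move=> k_gt0 lekT; pose c (x : T) := minn (enum_rank x) k.-1.
pose B (i : 'I_k) := [set x | c x == i].
have c_enum (i : 'I_k) : c (enum_val (widen_ord lekT i)) = i.
  by rewrite /c enum_valK /=; apply/minn_idPl; rewrite -ltnS prednK.
have [|i _|partB injB] := @indexed_partition _ _ 'I_k B.
- move=> i j _ _ neq_ji; apply/pred0P => x /=; rewrite !inE; apply/negP.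
  by move=> /andP[/eqP-> /eqP/val_inj eq_ij]; rewrite eq_ij eqxx in neq_ji.
- by apply/set0Pn; exists (enum_val (widen_ord lekT i)); rewrite inE c_enum.
exists [set B i | i in 'I_k]; rewrite inE card_in_imset // card_ord eqxx andbT.
suff <- : cover [set B i | i in 'I_k] = setT by [].
apply/setP=> x; rewrite inE; apply/bigcupP.
have ltck : (c x < k)%N by rewrite -[X in (_ < X)%N](prednK k_gt0) ltnS geq_minr.
by exists (B (Ordinal ltck)); rewrite ?imset_f // inE.
Qed.

(** * The quadratic form of the normalized Laplacian *)

Section Partition.
Variables (R : rcfType) (T : finType) (e : rel T).
Hypotheses (he : simple_graph e) (hiso : no_isolated e).
Local Notation n := #|T|.
Local Notation L := (normalized_laplacian e R).
Local Notation deg x := ((degree e x)%:R : R).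

Lemma normalized_laplacian_sym : L^T = L.
Proof.
rewrite /normalized_laplacian linearB /= trmx1 !trmx_mul tr_diag_mx mulmxA.
congr (_ - _ *m _ *m _); apply/matrixP=> i j.
by rewrite !mxE he.1.
Qed.

Lemma degree_gt0 x : 0 < deg x.
Proof.
by rewrite ltr0n; apply/card_gt0P; have [y exy] := hiso x; exists y; rewrite inE.
Qed.

Lemma degreeE x : deg x = \sum_y (e x y)%:R.
Proof.
rewrite /degree -sum1_card natr_sum big_mkcond /=.
by apply: eq_bigr => y _; rewrite inE; case: (e x y).
Qed.

Lemma edges_betweenE (A B : {set T}) :
  (edges_between e A B)%:R = \sum_(x in A) \sum_(y in B) (e x y)%:R :> R.
Proof.
rewrite /edges_between -sum1_card natr_sum pair_big big_mkcond [RHS]big_mkcond.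
apply: eq_bigr => -[x y] _; rewrite inE /=.
by case: (x \in A); case: (y \in B); case: (e x y).
Qed.

(** The vector D^{1/2} f, the substitution that turns the form of the normalized
    Laplacian into that of D - A. *)
Definition degree_scaled (f : T -> R) : 'rV[R]_n :=
  \row_j (Num.sqrt (deg (enum_val j)) * f (enum_val j)).

Lemma form1_degree_scaled f : form 1%:M (degree_scaled f) = \sum_x deg x * f x ^+ 2.
Proof.
rewrite /form mulmx1 mxE [RHS]big_enum_val.
by apply: eq_bigr => j _; rewrite !mxE -expr2 exprMn sqr_sqrtr.
Qed.

(** Both sides are sum_x d(x) f(x)^2 - sum_{x, y} e(x, y) f(x) f(y). The factor
    1/2 is there because the double sum meets every edge in both directions. *)
Lemma form_laplacian f : form L (degree_scaled f)
  = (\sum_x \sum_y (e x y)%:R * (f x - f y) ^+ 2) / 2.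
Proof.
have scaled : degree_scaled f *m inv_sqrt_degree e R = \row_j f (enum_val j).
  apply/rowP=> j; rewrite mul_mx_diag !mxE mulrAC mulfV ?mul1r //.
  by rewrite sqrtr_eq0 -ltNge degree_gt0.
have -> : form L (degree_scaled f) =
  \sum_x deg x * f x ^+ 2 - \sum_x \sum_y (e x y)%:R * (f x * f y).
  rewrite -form1_degree_scaled /form /normalized_laplacian mulmxBr mulmxBl mxE.
  rewrite !mulmxA scaled; congr (_ + _); rewrite mxE; congr (- _).
  rewrite -mulmxA -[inv_sqrt_degree e R in LHS]tr_diag_mx -trmx_mul scaled.
  rewrite mxE [RHS]big_enum_val; apply: eq_bigr => j _ /=.
  rewrite !mxE mulr_suml [RHS]big_enum_val; apply: eq_bigr => i _ /=.
  by rewrite !mxE he.1; ring.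
have sum_deg : \sum_x deg x * f x ^+ 2 = \sum_x \sum_y (e x y)%:R * f x ^+ 2.
  by apply: eq_bigr => x _; rewrite degreeE mulr_suml.
have sum_deg' : \sum_x deg x * f x ^+ 2 = \sum_x \sum_y (e x y)%:R * f y ^+ 2.
  rewrite sum_deg exchange_big; apply: eq_bigr => x _; apply: eq_bigr => y _.
  by rewrite he.1.
have -> : \sum_x \sum_y (e x y)%:R * (f x - f y) ^+ 2 =
  \sum_x deg x * f x ^+ 2 + \sum_x deg x * f x ^+ 2
  - (\sum_x \sum_y (e x y)%:R * (f x * f y)) * 2.
  rewrite {1}sum_deg sum_deg' mulr_suml -big_split -sumrB; apply: eq_bigr => x _.
  rewrite mulr_suml /= -big_split -sumrB /=; apply: eq_bigr => y _; ring.
by field.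
Qed.

(** * Functions constant on the classes of a partition *)

Variable (P : {set {set T}}).
Hypothesis partP : partition P [set: T].

Definition stepfun (g : {set T} -> R) (x : T) : R := g (pblock P x).

Lemma stepfun_class g A x : A \in P -> x \in A -> stepfun g x = g A.
Proof.
move=> PA Ax; rewrite /stepfun (def_pblock _ PA Ax) //.
exact: partition_trivIset partP.
Qed.

Lemma sum_over_classes (F : T -> R) : \sum_x F x = \sum_(A in P) \sum_(x in A) F x.
Proof.
by rewrite -(set_partition_big _ partP); apply: eq_bigl => x; rewrite inE.
Qed.

Lemma form1_stepfun g : form 1%:M (degree_scaled (stepfun g))
  = \sum_(A in P) (vol e A)%:R * g A ^+ 2.
Proof.
rewrite form1_degree_scaled sum_over_classes; apply: eq_bigr => A PA.
rewrite /vol natr_sum mulr_suml; apply: eq_bigr => x Ax.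
by rewrite (stepfun_class _ PA).
Qed.

Lemma form_laplacian_stepfun g : form L (degree_scaled (stepfun g))
  = (\sum_(A in P) \sum_(B in P) (edges_between e A B)%:R * (g A - g B) ^+ 2) / 2.
Proof.
rewrite form_laplacian sum_over_classes; congr (_ / _); apply: eq_bigr => A PA.
under eq_bigr do rewrite sum_over_classes.
rewrite exchange_big; apply: eq_bigr => B PB /=.
rewrite edges_betweenE mulr_suml; apply: eq_bigr => x Ax.
rewrite mulr_suml; apply: eq_bigr => y By.
by rewrite (stepfun_class _ PA Ax) (stepfun_class _ PB By).
Qed.

(** The Dirichlet energy of the complete graph on the classes. *)
Lemma sum_sqr_diff (g : {set T} -> R) :
  (\sum_(A in P) \sum_(B in P) (g A - g B) ^+ 2) / 2
  = #|P|%:R * (\sum_(A in P) g A ^+ 2) - (\sum_(A in P) g A) ^+ 2.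
Proof.
have sum_const (c : R) : \sum_(B in P) c = #|P|%:R * c.
  by rewrite sumr_const mulr_natl.
have -> : \sum_(A in P) \sum_(B in P) (g A - g B) ^+ 2
  = \sum_(A in P) (#|P|%:R * g A ^+ 2 + \sum_(B in P) g B ^+ 2
                   - g A * ((\sum_(B in P) g B) * 2)).
  apply: eq_bigr => A _; rewrite -sum_const mulrCA mulrA !mulr_suml.
  by rewrite -big_split -sumrB; apply: eq_bigr => B _ /=; ring.
rewrite sumrB big_split /= sum_const -mulr_suml -mulr_sumr.
by field.
Qed.

(** Row i is D^{1/2} times the indicator function of the i-th class. *)
Definition class_mx : 'M[R]_(#|P|, n) :=
  \matrix_(i, j) (Num.sqrt (deg (enum_val j))
                  * (pblock P (enum_val j) == enum_val i)%:R).

Definition class_coord (c : 'rV[R]_#|P|) (A : {set T}) : R :=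
  \sum_i c 0 i * (A == enum_val i)%:R.

Lemma class_mxE c : c *m class_mx = degree_scaled (stepfun (class_coord c)).
Proof.
apply/rowP=> j; rewrite !mxE mulr_sumr; apply: eq_bigr => i _.
by rewrite !mxE mulrCA.
Qed.

Lemma class_coord_enum c i : class_coord c (enum_val i) = c 0 i.
Proof.
rewrite /class_coord (bigD1 i) //= eqxx mulr1 big1 ?addr0 // => j neq_ji.
by rewrite (inj_eq enum_val_inj) eq_sym (negPf neq_ji) mulr0.
Qed.

(** The value of a step function at a vertex of the i-th class gives back its i-th
    coordinate, since degrees do not vanish and classes are nonempty. *)
Lemma class_mx_free : row_free class_mx.
Proof.
rewrite -kermx_eq0; apply/rowV0P => c /sub_kermxP cW0; apply/rowP=> i.
have /set0Pn[x Ax] := partition_neq0 partP (enum_valP i).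
have := congr1 (fun u : 'rV_n => u 0 (enum_rank x)) cW0.
rewrite class_mxE !mxE enum_rankK (stepfun_class _ (enum_valP i) Ax).
rewrite class_coord_enum => /eqP; rewrite mulf_eq0 sqrtr_eq0.
by rewrite leNgt degree_gt0 => /eqP.
Qed.

Lemma sum_class_coord c : \sum_(A in P) class_coord c A = \sum_i c 0 i.
Proof.
by rewrite big_enum_val; apply: eq_bigr => i _; rewrite class_coord_enum.
Qed.


(** * Bounds for one partition *)

Lemma cross_counts_ge0 x : x \in cross_counts e R P -> 0 <= x.
Proof. by move=> /imageP[c _ ->]; apply: ler0n. Qed.

Lemma cross_counts_mem A B : A \in P -> B \in P -> A != B ->
  (edges_between e A B)%:R \in cross_counts e R P.
Proof.
by move=> PA PB neqAB; apply/imageP; exists (A, B); rewrite // inE /= PA PB.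
Qed.

Lemma volumes_gt0 x : x \in volumes e R P -> 0 < x.
Proof.
move=> /imageP[A PA ->]; rewrite /vol natr_sum.
have /set0Pn[x0 Ax0] := partition_neq0 partP PA.
by rewrite (bigD1 x0) //= ltr_pwDl ?degree_gt0 // sumr_ge0.
Qed.

Lemma volumes_mem A : A \in P -> (vol e A)%:R \in volumes e R P.
Proof. by move=> PA; apply/imageP; exists A. Qed.

Lemma volumes_nonnil : P != set0 -> volumes e R P != [::].
Proof. by move=> /set0Pn[A /volumes_mem]; case: (volumes e R P). Qed.

(** Each e(A, B) is replaced by the largest one, then the term (sum_A g_A)^2 of
    the complete graph energy is dropped, and each volume is replaced by the
    smallest one. *)
Lemma form_laplacian_le_gamma_star g : P != set0 ->
  form L (degree_scaled (stepfun g))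
  <= gamma_star e R P * #|P|%:R * form 1%:M (degree_scaled (stepfun g)).
Proof.
move=> P_neq0; rewrite form_laplacian_stepfun form1_stepfun /gamma_star.
set M := maxseq _; set v := minseq _.
have v_gt0 : 0 < v by apply/volumes_gt0/minseq_mem/volumes_nonnil.
have M_ge0 : 0 <= M.
  rewrite /M; have [->|/maxseq_mem/cross_counts_ge0//] :=
    eqVneq (cross_counts e R P) [::].
  by rewrite /maxseq big_nil.
apply: (@le_trans _ _ (M * (#|P|%:R * \sum_(A in P) g A ^+ 2))).
  apply: (@le_trans _ _ (M * ((\sum_(A in P) \sum_(B in P) (g A - g B) ^+ 2) / 2)));
    last first.
    by rewrite ler_wpM2l // sum_sqr_diff lerBlDr lerDl sqr_ge0.
  rewrite mulrA ler_wpM2r ?invr_ge0 // mulr_sumr ler_sum // => A PA.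
  rewrite mulr_sumr ler_sum // => B PB.
  have [->|neqAB] := eqVneq A B; first by rewrite subrr expr0n !mulr0.
  by rewrite ler_wpM2r ?sqr_ge0 // maxseq_ge // cross_counts_mem.
rewrite -!mulrA ler_wpM2l // mulrCA ler_wpM2l // mulr_sumr ler_sum // => A PA.
rewrite mulrA ler_peMl ?sqr_ge0 // mulrC ler_pdivlMr // mul1r.
by rewrite minseq_le // volumes_mem.
Qed.

(** The condition on [g] cancels the negative term (sum_A g_A)^2 of the complete
    graph energy, so that the smallest e(A, B) and the largest volume give a
    bound from below. *)
Lemma form_laplacian_ge_gamma g : P != set0 -> \sum_(A in P) g A = 0 ->
  gamma e R P * #|P|%:R * form 1%:M (degree_scaled (stepfun g))
  <= form L (degree_scaled (stepfun g)).
Proof.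
move=> P_neq0 g0; rewrite form_laplacian_stepfun form1_stepfun /gamma.
set m := minseq _; set v := maxseq _.
have v_gt0 : 0 < v by apply/volumes_gt0/maxseq_mem/volumes_nonnil.
have m_ge0 : 0 <= m.
  rewrite /m; have [->|/minseq_mem/cross_counts_ge0//] :=
    eqVneq (cross_counts e R P) [::].
  by rewrite /minseq big_nil.
apply: (@le_trans _ _ (m * (#|P|%:R * \sum_(A in P) g A ^+ 2))).
  rewrite -!mulrA ler_wpM2l // mulrCA ler_wpM2l // mulr_sumr ler_sum // => A PA.
  rewrite mulrA ler_piMl ?sqr_ge0 // mulrC ler_pdivrMr // mul1r.
  by rewrite maxseq_ge // volumes_mem.
rewrite -[X in m * X]subr0 -[X in _ - X](expr0n _ 2) -[in X in _ - X]g0 -sum_sqr_diff.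
rewrite mulrA ler_wpM2r ?invr_ge0 // mulr_sumr ler_sum // => A PA.
rewrite mulr_sumr ler_sum // => B PB.
have [->|neqAB] := eqVneq A B; first by rewrite subrr expr0n !mulr0.
by rewrite ler_wpM2r ?sqr_ge0 // minseq_le // cross_counts_mem.
Qed.

Variable lam : seq R.
Hypothesis hlam : ordered_spectrum L lam.

Lemma eigenvalue_le_gamma_star : P != set0 ->
  lam`_(#|P| - 1) <= gamma_star e R P * #|P|%:R.
Proof.
move=> P_neq0; have rankW := eqP class_mx_free; rewrite -{1}rankW.
apply: (eigenvalue_le normalized_laplacian_sym hlam).
  by rewrite rankW card_gt0.
move=> u /submxP[c ->]; rewrite class_mxE.
exact: form_laplacian_le_gamma_star.
Qed.

(** Its row space is the hyperplane of the class values with zero sum. *)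
Definition sum0_mx : 'M[R]_#|P| := kermx (const_mx 1 : 'cV[R]_#|P|).

Lemma rank_sum0_mx : P != set0 -> \rank sum0_mx = (#|P| - 1)%N.
Proof.
rewrite -card_gt0 => P_gt0; rewrite mxrank_ker; congr (_ - _)%N.
apply/eqP; rewrite eqn_leq rank_leq_col lt0n mxrank_eq0.
apply/eqP=> /matrixP/(_ (Ordinal P_gt0) 0); rewrite !mxE => /eqP.
by rewrite oner_eq0.
Qed.

Lemma gamma_le_eigenvalue : (1 < #|P|)%N ->
  gamma e R P * #|P|%:R <= lam`_(n - (#|P| - 1)).
Proof.
move=> P_gt1; have P_neq0 : P != set0 by rewrite -card_gt0 ltnW.
have rankU : \rank (sum0_mx *m class_mx) = (#|P| - 1)%N.
  by rewrite mxrankMfree ?class_mx_free ?rank_sum0_mx.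
rewrite -[in leRHS]rankU.
apply: (eigenvalue_ge normalized_laplacian_sym hlam).
  by rewrite rankU subn_gt0.
move=> u /submxP[c ->]; rewrite mulmxA class_mxE.
apply: form_laplacian_ge_gamma => //; rewrite sum_class_coord.
have /sub_kermxP/matrixP/(_ 0 0) : (c *m sum0_mx <= sum0_mx)%MS by apply: submxMl.
rewrite !mxE => {2}<-; apply: eq_bigr => i _; rewrite [const_mx _ _ _]mxE mulr1 //.
Qed.

End Partition.

Theorem theorem11 (R : rcfType) (T : finType) (e : rel T)
    (he : simple_graph e) (hiso : no_isolated e)
    (k : nat) (hk2 : (2 <= k)%N) (hkn : (k <= #|T|)%N)
    (lam : seq R) (hlam : ordered_spectrum (normalized_laplacian e R) lam) :
  psi e R k * k%:R <= lam`_(#|T| - (k - 1)) /\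
  lam`_(k - 1) <= phi e R k * k%:R.
Proof.
have [P0 P0k] := kpartitions_nonempty (ltnW hk2) hkn.
have image_nonnil (F : {set {set T}} -> R) :
    [seq F P | P : {set {set T}} in kpartitions T k] != [::].
  by apply/eqP=> E; have := image_f F P0k; rewrite E.
rewrite /psi /phi; split.
  have /imageP[P + ->] := maxseq_mem (image_nonnil (gamma e R)).
  rewrite inE => /andP[partP /eqP cardP]; rewrite -cardP.
  by apply: gamma_le_eigenvalue; rewrite ?cardP.
have /imageP[P + ->] := minseq_mem (image_nonnil (gamma_star e R)).
rewrite inE => /andP[partP /eqP cardP]; rewrite -cardP.
apply: eigenvalue_le_gamma_star => //.
by rewrite -card_gt0 cardP ltnW.
Qed.
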